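(* Let $G = \langle A * B;\ H\rangle$ be the generalized free product of groups $A$ and $B$ with amalgamated subgroup $H$, let $\mathfrak{P}$ be a non-empty set of primes, and suppose that $H$ is nilpotent. Suppose also that $(\alpha)$ $H$ does not coincide with its normalizer in $A$ or is properly contained in some subgroup of $A$ satisfying a non-trivial identity; $(\beta)$ $H$ does not coincide with its normalizer in $B$ or is properly contained in some subgroup of $B$ satisfying a non-trivial identity. Then the following statements hold. 1. If $G$ is residually an $\mathcal{FN}_{\mathfrak{P}}$-group, then $H$ is $q'$-isolated in $A$ and in $B$ for some $q \in \mathfrak{P}$. 2. If $G$ is residually a $\mathcal{C}$-group for some subclass $\mathcal{C}$ of the class $\mathcal{F}_{\mathfrak{P}}$ and $\mathcal{C}$ is closed under taking subgroups, then $H$ is $\mathcal{C}$-separable, and therefore $\mathfrak{P}'$-isolated, in $A$ and in $B$.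
   Context: $G=\langle A*B;\ H\rangle$ means that $G$ is the generalized (amalgamated) free product of $A$ and $B$ with amalgamated subgroup $H$; $A$ and $B$ are regarded as subgroups of $G$, with $A\cap B=H$. For a set of primes $\mathfrak{P}$, a $\mathfrak{P}$-group is a periodic group in which all prime divisors of orders of elements lie in $\mathfrak{P}$; $\mathcal{F}_{\mathfrak{P}}$ and $\mathcal{FN}_{\mathfrak{P}}$ are the classes of finite $\mathfrak{P}$-groups and finite nilpotent $\mathfrak{P}$-groups. Classes of groups are, as usual, closed under isomorphism. A group $X$ is residually a $\mathcal{C}$-group if for every $x\in X\setminus\{1\}$ there is a homomorphism $\sigma$ of $X$ onto a group from $\mathcal{C}$ with $x\sigma\neq1$. A subgroup $Y\leqslant X$ is $\mathcal{C}$-separable in $X$ if for every $x\in X\setminus Y$ there is a homomorphism $\sigma$ of $X$ onto a group from $\mathcal{C}$ with $x\sigma\notin Y\sigma$. $\mathfrak{P}'$ is the set of all primes not in $\mathfrak{P}$, and $q'=\{q\}'$. For a set $\mathfrak{S}$ of primes, a subgroup $Y\leqslant X$ is $\mathfrak{S}$-isolated in $X$ if for every $r\in\mathfrak{S}$ and $x\in X$, $x^r\in Y$ implies $x\in Y$. *)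

(* Defs.v *)
From mathcomp Require Import all_boot.
From mathcomp Require Import boolp classical_sets functions cardinality.

Set Implicit Arguments.
Unset Strict Implicit.
Unset Printing Implicit Defensive.

Local Open Scope classical_set_scope.
Local Open Scope group_scope.

(* Groups are MathComp's [groupType] (not necessarily finite), subgroups are
   classical sets, and a class of groups is a predicate on [groupType]. *)

Definition is_subgroup (X : groupType) (M : set X) : Prop :=
  M 1 /\ forall x y, M x -> M y -> M (x / y).

Definition normalizer (X : groupType) (Y : set X) : set X :=
  [set x | forall y, Y (y ^ x) <-> Y y].

Definition generated (X : groupType) (S : set X) : set X :=
  smallest (@is_subgroup X) S.

Fixpoint lower_central (X : groupType) (n : nat) : set X :=
  if n is m.+1
  then generated [set z | exists2 x, lower_central m x &
                          exists y, z = [~ x, y]]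
  else [set: X].

Definition nilpotent_group (X : groupType) : Prop :=
  exists n, @lower_central X n = [set 1].

(* The letter [(i, true)] stands for the i-th variable and [(i, false)] for
   its inverse. *)
Definition word := seq (nat * bool).

Definition reduced (w : word) : bool :=
  sorted [rel a b | ~~ ((a.1 == b.1) && (a.2 != b.2))] w.

Definition eval_word (X : groupType) (v : nat -> X) (w : word) : X :=
  \prod_(a <- w) (if a.2 then v a.1 else (v a.1)^-1).

(* Non-trivial elements of the free group of countable rank are the non-empty
   reduced words. *)
Definition satisfies_nontrivial_identity (X : groupType) (M : set X) : Prop :=
  exists w : word, [/\ w <> [::], reduced w &
    forall v : nat -> X, (forall i, M (v i)) -> eval_word v w = 1].

Definition has_order (X : groupType) (x : X) (n : nat) : Prop :=
  [/\ (0 < n)%N, x ^+ n = 1 &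
    forall m, (0 < m)%N -> x ^+ m = 1 -> (n <= m)%N].

Definition P_group (P : set nat) (X : groupType) : Prop :=
  forall x : X, exists2 n, has_order x n &
    forall p, prime p -> (p %| n)%N -> P p.

Definition finite_P_group (P : set nat) (X : groupType) : Prop :=
  finite_set [set: X] /\ P_group P X.

Definition finite_nilpotent_P_group (P : set nat) (X : groupType) : Prop :=
  finite_P_group P X /\ nilpotent_group X.

(* Subgroups are taken up to isomorphism, as domains of injective
   homomorphisms; this includes closure under isomorphism. *)
Definition closed_under_subgroups (C : groupType -> Prop) : Prop :=
  forall (X Y : groupType) (f : {multiplicative Y -> X}),
    injective f -> C X -> C Y.

Definition residually (C : groupType -> Prop) (X : groupType) : Prop :=
  forall x : X, x <> 1 ->
    exists (K : groupType) (s : {multiplicative X -> K}),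
      [/\ C K, range s = [set: K] & s x <> 1].

Definition separable (C : groupType -> Prop) (X : groupType) (Y : set X) :
    Prop :=
  forall x : X, ~ Y x ->
    exists (K : groupType) (s : {multiplicative X -> K}),
      [/\ C K, range s = [set: K] & ~ (s @` Y) (s x)].

Definition compl_primes (S : set nat) : set nat :=
  [set p | prime p /\ ~ S p].

Definition isolated (S : set nat) (X : groupType) (Y : set X) : Prop :=
  forall (r : nat) (x : X), S r -> Y (x ^+ r) -> Y x.

(* [G], with the maps [jA] and [jB], is the free product of [A] and [B] in
   which the subgroups [range iA] and [range iB], both copies of [H], are
   amalgamated. It is given by its universal property; since [iA] and [iB] are
   injective, [jA] and [jB] are embeddings whose images meet exactly in the
   image of [H], by Schreier's theorem. *)
Definition is_amalgamated_product (H A B G : groupType)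
    (iA : {multiplicative H -> A}) (iB : {multiplicative H -> B})
    (jA : {multiplicative A -> G}) (jB : {multiplicative B -> G}) : Prop :=
  [/\ injective iA, injective iB, (forall h, jA (iA h) = jB (iB h)) &
    forall (K : groupType) (f : {multiplicative A -> K})
           (g : {multiplicative B -> K}),
      (forall h, f (iA h) = g (iB h)) ->
      exists u : {multiplicative G -> K},
        [/\ (forall a, u (jA a) = f a), (forall b, u (jB b) = g b) &
          forall u' : {multiplicative G -> K},
            (forall a, u' (jA a) = f a) -> (forall b, u' (jB b) = g b) ->
            forall x, u' x = u x]].

Definition self_normalizing (X : groupType) (Y : set X) : Prop :=
  normalizer Y = Y.

Definition properly_in_subgroup_with_identity (X : groupType) (Y : set X) :
    Prop :=
  exists M : set X,
    [/\ is_subgroup M, Y `<` M & satisfies_nontrivial_identity M].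

(* Main.v *)
Require Import Defs.
From HB Require Import structures.
From mathcomp Require Import all_boot all_fingroup all_solvable.
From mathcomp Require Import boolp classical_sets functions cardinality.

Set Implicit Arguments.
Unset Strict Implicit.
Unset Printing Implicit Defensive.

Local Open Scope classical_set_scope.
Local Open Scope group_scope.

(** The proof attaches to every element [x] of a factor outside [H] an element
    [y] of the amalgam that is a non-empty alternating word in letters from
    [A \ H] and [B \ H], hence non-trivial, and that nevertheless dies in every
    homomorphism [f] with [f x] in [f H] ([exists_killed_word]).

    Say that [x] lies in [A]. If some [b] in [B \ H] normalizes [H], then
    [f x] in [f H] implies the same for [x ^ b], so [x] and [x ^ b] go into the
    nilpotent group [f H], and a sufficiently long iterated commutator of the
    two can be taken for [y]. Otherwise [H] is properly contained in a subgroup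
    [M] of [B] with an identity [w]. Then [M] contains at least three cosets of
    [H], so that [x] and [M] generate a group with enough room for free
    elements, and [y] is the value of [w] at such elements: it dies when [x]
    enters the image of [H], as the free elements then enter the image of [M].

    A residual property of the amalgam yields a quotient in which [y] survives,
    so in which [x] stays outside the image of [H]. This gives separability,
    by restricting the quotient map to a factor, and it gives isolation for the
    primes outside [P], since in a [P]-group [x] is a power of [x ^+ r] for
    these primes.

    For residually nilpotent amalgams, suppose that for two different primes
    [r1] and [r2] there are elements [x1] and [x2] outside [H] with
    [x1 ^+ r1] and [x2 ^+ r2] in [H]. In a finite nilpotent quotient, reduced
    modulo its Sylow [r1]-subgroup, [x1] falls into the image of [H]; so the
    word [y1] attached to [x1] goes into the Sylow [r1]-subgroup, and likewise
    [y2] goes into the Sylow [r2]-subgroup. Thus all conjugates of [y1] and [y2]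
    commute in the amalgam. But one of the primes is odd, so that the square of
    [x1] or of [x2] is outside [H], and this suffices to find conjugates whose
    commutator is an alternating word ([commutator_alternating]). Hence at most
    one prime occurs as the exponent of such a missing root, and isolation
    for the primes outside [P] puts it in [P].

    That alternating words are non-trivial ([alternating_neq1]) is deduced from
    the universal property with the action of van der Waerden on normal
    forms. *)

(** * Homomorphisms and subgroups *)

Section Homomorphisms.
Variables (G K : groupType) (f : {multiplicative G -> K}).

Lemma hom1 : f 1 = 1.
Proof. by apply: (@mulgI _ (f 1)); rewrite -gmulfM !mulg1. Qed.

Definition group_hom : UMagmaMorphism.type G K :=
  HB.pack (Multiplicative.sort f)
    (Multiplicative_isUMagmaMorphism.Build G K f hom1).

Lemma homV : {morph f : x / x^-1}. Proof. exact: (gmulfV group_hom). Qed.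
Lemma homX n : {morph f : x / x ^+ n}. Proof. exact: (gmulfXn group_hom). Qed.
Lemma homJ : {morph f : x y / x ^ y}. Proof. exact: (gmulfJ group_hom). Qed.
Lemma homR : {morph f : x y / [~ x, y]}.
Proof. exact: (gmulfR group_hom). Qed.

Lemma hom_inj : (forall x, f x = 1 -> x = 1) -> injective f.
Proof. exact: (gmulf_inj (f := group_hom)). Qed.

Lemma hom_eval_word (v : nat -> G) (w : word) :
  f (eval_word v w) = eval_word (f \o v) w.
Proof.
rewrite /eval_word (gmulf_prod group_hom).
by apply: eq_bigr => -[i []] _ //=; rewrite homV.
Qed.

End Homomorphisms.

Section Subgroups.
Variables (G : groupType) (M : set G).
Hypothesis subM : is_subgroup M.

Lemma subgroupV x : M x -> M x^-1.
Proof. by move=> Mx; rewrite -div1g; apply: subM.2 => //; apply: subM.1. Qed.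

Lemma subgroupM x y : M x -> M y -> M (x * y).
Proof.
by move=> Mx My; rewrite -[y]invgK; apply: subM.2 => //; apply: subgroupV.
Qed.

Lemma subgroupX x n : M x -> M (x ^+ n).
Proof.
move=> Mx; elim: n => [|n IHn]; first by rewrite expg0; apply: subM.1.
by rewrite expgS; apply: subgroupM.
Qed.

Lemma subgroup_image (K : groupType) (f : {multiplicative G -> K}) :
  is_subgroup (f @` M).
Proof.
split=> [|_ _ [x Mx <-] [y My <-]].
  by exists 1; [apply: subM.1 | apply: hom1].
by exists (x * y^-1); [apply: subM.2 | rewrite gmulfM homV].
Qed.

End Subgroups.

Lemma subgroup_range (G K : groupType) (f : {multiplicative G -> K}) :
  is_subgroup (range f).
Proof. by apply: subgroup_image; split. Qed.

(** On elements of order prime to [r], taking [r]-th powers can be undone by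
    taking another power: this is how an [r]-th power in a subgroup brings the
    element itself into the subgroup. *)
Lemma coprime_root (G : groupType) (x : G) (r n : nat) :
  (0 < r)%N -> coprime r n -> x ^+ n = 1 -> exists m, (x ^+ r) ^+ m = x.
Proof.
move=> r_gt0 co_rn xn1; have [m n' eq_mn _] := egcdnP n r_gt0.
exists m; rewrite -expgnA mulnC eq_mn (eqP co_rn) expgnDr expg1 mulnC expgnA.
by rewrite xn1 expg1n mul1g.
Qed.

(** * Alternating words *)

Section Alternating.
Variables (G : groupType) (L : bool -> set G).

(** The two indices record the sides of the outer letters, which decide what a
    word may be glued to. Gluing two words, instead of adding one letter, makes
    the class visibly stable under inversion. *)
Inductive alternating : bool -> bool -> G -> Prop :=
| alternating_letter s x : L s x -> alternating s s x
| alternating_mul s t u x y :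
    alternating s t x -> alternating (~~ t) u y -> alternating s u (x * y).

Hypothesis letterV : forall s x, L s x -> L s x^-1.

Lemma alternatingV s t x : alternating s t x -> alternating t s x^-1.
Proof.
elim=> {s t x} [s x Lx | s t u x y _ IHx _ IHy].
  by apply: alternating_letter; apply: letterV.
by rewrite invgM; apply: alternating_mul IHy _; rewrite negbK.
Qed.

Lemma alternating_first s t x : alternating s t x ->
  L s x /\ s = t \/ exists l y, [/\ L s l, alternating (~~ s) t y & x = l * y].
Proof.
elim=> {s t x} [s x Lx | s t u x y altx IHx alty _]; first by left.
right; case: IHx => [[Lx eq_st]|[l [z [Ll altz ->]]]].
  by exists x, y; split=> //; rewrite eq_st.
by exists l, (z * y); split=> //; [apply: alternating_mul alty | rewrite mulgA].
Qed.

End Alternating.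

(** Taking both factors as one family indexed by [bool] lets every later
    argument about words treat the two sides of the amalgam at once. *)
Definition letters (G : groupType) (H0 : set G) (X : bool -> set G) s : set G :=
  X s `\` H0.

(** * The group of bijections of a type *)

(** The universal property of an amalgam is only of use through some target
    group; permutations of an arbitrary, possibly infinite, type provide it. *)
Record bijection (T : Type) := Bijection {
  bij_fun :> T -> T;
  bij_inv : T -> T;
  bij_funK : cancel bij_fun bij_inv;
  bij_invK : cancel bij_inv bij_fun
}.

HB.instance Definition _ (T : Type) := gen_eqMixin (bijection T).
HB.instance Definition _ (T : Type) := gen_choiceMixin (bijection T).

Section BijectionGroup.
Variable T : Type.
Implicit Types f g h : bijection T.

Lemma bijectionP f g : f =1 g -> f = g.
Proof.
case: f g => [f f' fK f'K] [g g' gK g'K] /= /funext eq_fg; subst g.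
suff eq_fg' : f' = g'.
  by subst g'; congr Bijection; apply: Prop_irrelevance.
by apply: funext => x; rewrite -[x in LHS]g'K fK.
Qed.

Definition bij_one := @Bijection T id id (fun=> erefl) (fun=> erefl).
Definition bij_comp f g :=
  Bijection (can_comp (bij_funK f) (bij_funK g))
            (can_comp (bij_invK g) (bij_invK f)).
Definition bij_flip f := Bijection (bij_invK f) (bij_funK f).

Lemma bij_compA : associative bij_comp.
Proof. by move=> f g h; apply: bijectionP. Qed.
Lemma bij_comp1 : left_id bij_one bij_comp.
Proof. by move=> f; apply: bijectionP. Qed.
Lemma bij_1comp : right_id bij_one bij_comp.
Proof. by move=> f; apply: bijectionP. Qed.
Lemma bij_compV : left_inverse bij_one bij_flip bij_comp.
Proof. by move=> f; apply: bijectionP => x; apply: bij_funK. Qed.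
Lemma bij_Vcomp : right_inverse bij_one bij_flip bij_comp.
Proof. by move=> f; apply: bijectionP => x; apply: bij_invK. Qed.

HB.instance Definition _ := isGroup.Build (bijection T)
  bij_compA bij_comp1 bij_1comp bij_compV bij_Vcomp.

End BijectionGroup.

(** * Normal forms *)

(** [k a] is the part of [a] in [H] relative to a right transversal of [H] that
    contains 1: dividing [k0 a] by [k0 1] turns any choice of representatives
    into one that represents [H] itself by 1. *)
Lemma equivariant_retraction (H A : groupType) (i : {multiplicative H -> A}) :
  injective i ->
  exists k : A -> H, (forall h a, k (i h * a) = h * k a) /\ cancel i k.
Proof.
move=> inj_i.
pose coset a := [set x | exists h, x = i h * a].
pose rep a := xget 1 (coset a).
have rep_coset a : exists h, a = i h * rep a.
  have: coset a (rep a).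
    by apply: (@xgetPex _ 1 (coset a)); exists (i 1 * a), 1.
  by move=> [h ->]; exists h^-1; rewrite mulgA -gmulfM mulVg hom1 mul1g.
have repM h a : rep (i h * a) = rep a.
  rewrite /rep; congr xget; apply/seteqP; split=> x [h' ->].
    by exists (h' * h); rewrite gmulfM mulgA.
  by exists (h' * h^-1); rewrite mulgA -gmulfM mulgVK.
have [k kE] := choice rep_coset.
have kM h a : k (i h * a) = h * k a.
  apply: inj_i; apply: (@mulIg _ (rep a)).
  by rewrite -{1}(repM h a) -kE gmulfM -mulgA -kE.
exists (fun a => k a * (k 1)^-1); split=> [h a|h]; first by rewrite kM mulgA.
by rewrite -[i h]mulg1 kM mulgK.
Qed.

(** Words over [S] and [T] whose letters alternate, starting in [T]: exchanging
    the parameters at each letter is what enforces the alternation. *)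
Inductive rep_word (S T : Type) : Type :=
| Empty
| Letter of T & rep_word T S.

Arguments Empty {S T}.
Arguments Letter {S T}.

(** Representatives of the cosets other than [H] itself. *)
Definition transversal (H A : groupType) (k : A -> H) :=
  {t : A | (k t == 1) && (t != 1)}.

Section ChangeOfFactor.
Variables (H A B : groupType).
Variables (iA : {multiplicative H -> A}) (iB : {multiplicative H -> B}).
Variables (kA : A -> H) (kB : B -> H).
Hypotheses (kAM : forall h a, kA (iA h * a) = h * kA a) (iAK : cancel iA kA).

Local Notation TA := (transversal kA).
Local Notation TB := (transversal kB).

(** A normal form [h * t1 * t2 * ...] can be read either as an element of [A]
    followed by representatives starting in [TB], or as an element of [B]
    followed by representatives starting in [TA]. This is the passage from
    the first reading to the second. The group [A] acts by translation on the
    first reading and [B] on the second, so that no case distinction is needed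
    to see that these are actions. *)
Definition change_factor (u : A * rep_word TA TB) : B * rep_word TB TA :=
  let h := kA u.1 in
  if insub ((iA h)^-1 * u.1) is Some t then (iB h, Letter t u.2)
  else if u.2 is Letter t w then (iB h * val t, w) else (iB h, Empty).

Variant change_factor_spec :
  H -> A * rep_word TA TB -> B * rep_word TB TA -> Prop :=
| ChangeEmpty h : change_factor_spec h (iA h, Empty) (iB h, Empty)
| ChangeLetter h t w : change_factor_spec h (iA h, Letter t w) (iB h * val t, w)
| ChangeCons h t w : change_factor_spec h (iA h * val t, w) (iB h, Letter t w).

Lemma change_factorP u : change_factor_spec (kA u.1) u (change_factor u).
Proof.
case: u => a w; rewrite /change_factor /=.
case: insubP => [t _ eq_t|].
  rewrite -[a in X in change_factor_spec _ X](mulVKg (iA (kA a))) -eq_t.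
  by constructor.
rewrite -homV kAM mulVg eqxx negbK => /eqP eq1.
have -> : a = iA (kA a) by rewrite -[LHS](mulg1_eq eq1) homV invgK.
by rewrite iAK; case: w => [|t w]; constructor.
Qed.

Lemma change_factor_empty h : change_factor (iA h, Empty) = (iB h, Empty).
Proof.
rewrite /change_factor /= iAK; case: insubP => //= t.
by rewrite -homV -gmulfM mulVg hom1 eqxx andbF.
Qed.

Lemma change_factor_letter h t w :
  change_factor (iA h, Letter t w) = (iB h * val t, w).
Proof.
rewrite /change_factor /= iAK; case: insubP => //= t'.
by rewrite -homV -gmulfM mulVg hom1 eqxx andbF.
Qed.

Lemma change_factor_cons h (t : TA) w :
  change_factor (iA h * val t, w) = (iB h, Letter t w).
Proof.
have /andP[/eqP kt1 _] := valP t.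
by rewrite /change_factor /= kAM kt1 mulg1 mulKg valK.
Qed.

End ChangeOfFactor.

Section Translation.
Variables (A : groupType) (V W : Type) (f : V -> A * W) (f' : A * W -> V).
Hypotheses (fK : cancel f f') (f'K : cancel f' f).

Definition shift a (u : A * W) : A * W := (a * u.1, u.2).

Lemma shiftK a : cancel (f' \o shift a \o f) (f' \o shift a^-1 \o f).
Proof. by move=> v; rewrite /= f'K /shift /= mulKg -surjective_pairing. Qed.

Lemma shiftVK a : cancel (f' \o shift a^-1 \o f) (f' \o shift a \o f).
Proof. by move=> v; rewrite /= f'K /shift /= mulVKg -surjective_pairing. Qed.

Definition translation a : bijection V := Bijection (shiftK a) (shiftVK a).

Lemma translationM : {morph translation : a b / a * b}.
Proof.
by move=> a b; apply: bijectionP => v; rewrite /= f'K /shift /= mulgA.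
Qed.

HB.instance Definition _ :=
  isMultiplicative.Build A (bijection V) translation translationM.

End Translation.

Lemma change_factorK (H A B : groupType)
    (iA : {multiplicative H -> A}) (iB : {multiplicative H -> B})
    (kA : A -> H) (kB : B -> H) :
    (forall h a, kA (iA h * a) = h * kA a) -> cancel iA kA ->
    (forall h b, kB (iB h * b) = h * kB b) -> cancel iB kB ->
  cancel (@change_factor H A B iA iB kA kB) (@change_factor H B A iB iA kB kA).
Proof.
move=> kAM iAK kBM iBK u.
case: (change_factorP iB kAM iAK u) => {u} [h|h t w|h t w].
- by rewrite change_factor_empty.
- by rewrite change_factor_cons.
- by rewrite change_factor_letter.
Qed.

Section NormalFormAction.
Variables (H A B : groupType).
Variables (iA : {multiplicative H -> A}) (iB : {multiplicative H -> B}).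
Variables (kA : A -> H) (kB : B -> H).
Hypotheses (kAM : forall h a, kA (iA h * a) = h * kA a) (iAK : cancel iA kA).
Hypotheses (kBM : forall h b, kB (iB h * b) = h * kB b) (iBK : cancel iB kB).

Let V := (A * rep_word (transversal kA) (transversal kB))%type.
Let toB := @change_factor H A B iA iB kA kB.
Let ofB := @change_factor H B A iB iA kB kA.
Let toBK : cancel toB ofB. Proof. exact: change_factorK. Qed.
Let ofBK : cancel ofB toB. Proof. exact: change_factorK. Qed.

Definition actA : {multiplicative A -> bijection V} :=
  @translation A V _ id id (fun v => erefl v) (fun v => erefl v).
Definition actB : {multiplicative B -> bijection V} := translation toBK ofBK.

(** Both readings of a normal form have the same part in [H], and [H] acts only
    on that part: this is why the two actions fit together. *)
Lemma act_amalgam h : actA (iA h) = actB (iB h).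
Proof.
apply: bijectionP => v; apply: (can_inj toBK); rewrite /= ofBK /shift /= /toB.
case: (change_factorP iB kAM iAK v) => {v} [h'|h' t w|h' t w] /=.
- by rewrite -gmulfM change_factor_empty // gmulfM.
- by rewrite -gmulfM change_factor_letter // gmulfM mulgA.
- by rewrite mulgA -[iA h * _]gmulfM change_factor_cons // gmulfM.
Qed.

(** Normal forms whose first syllable lies in [A] ([s = true]) or in [B]
    ([s = false]); those that lie in [H] start on neither side. *)
Definition starts (s : bool) : set V :=
  if s then [set v | ~ range iA v.1] else [set v | ~ range iB (toB v).1].

Lemma starts_disjoint v : starts true v -> ~ starts false v.
Proof.
rewrite /= /toB; case: (change_factorP iB kAM iAK v) => {v} [h|h t w|h t w] /=.
- by case; exists h.
- by case; exists h.
- by move=> _; case; exists h.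
Qed.

Lemma starts_base : ~ starts true (1, Empty) /\ ~ starts false (1, Empty).
Proof.
rewrite /= /toB -(hom1 iA) change_factor_empty // hom1.
by split; apply; exists 1; rewrite // hom1.
Qed.

Lemma actA_starts a v : ~ range iA a -> ~ starts true v ->
  starts true (actA a v).
Proof.
move=> nHa /contrapT Hv /= Hav; apply: nHa; rewrite -(mulgK v.1 a).
apply: (subgroupM (subgroup_range iA)) => //.
exact: (subgroupV (subgroup_range iA)).
Qed.

Lemma actB_starts b v : ~ range iB b -> ~ starts false v ->
  starts false (actB b v).
Proof.
move=> nHb /contrapT Hv /=; rewrite ofBK /= => Hbv; apply: nHb.
rewrite -(mulgK (toB v).1 b).
apply: (subgroupM (subgroup_range iB)) => //.
exact: (subgroupV (subgroup_range iB)).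
Qed.

End NormalFormAction.

Section NormalForm.
Variables (H A B G : groupType).
Variables (iA : {multiplicative H -> A}) (iB : {multiplicative H -> B}).
Variables (jA : {multiplicative A -> G}) (jB : {multiplicative B -> G}).
Hypothesis amalgG : is_amalgamated_product iA iB jA jB.

Definition amalgamated : set G := range (jA \o iA).
Definition factor (s : bool) : set G := if s then range jA else range jB.

Lemma amalgam_swap : is_amalgamated_product iB iA jB jA.
Proof.
case: amalgG => inj_iA inj_iB jAB univ; split=> // K f g fg.
have [|u [uA uB uniq_u]] := univ K g f; first by move=> h; rewrite fg.
by exists u; split=> // u' u'B u'A; apply: uniq_u.
Qed.

Lemma factor_injective : injective jA.
Proof.
case: amalgG => inj_iA inj_iB jAB univ.
have [kA [kAM iAK]] := equivariant_retraction inj_iA.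
have [kB [kBM iBK]] := equivariant_retraction inj_iB.
have [u [uA _ _]] := univ _ _ _ (act_amalgam kAM iAK kBM iBK).
apply: hom_inj => a ja1; have := uA a; rewrite ja1 hom1.
move/(congr1 (fun b : bijection _ => (b (1, Empty)).1)) => /=.
by rewrite mulg1 => <-.
Qed.

(** A letter from one side sends every normal form that does not start on that
    side to one that does. Hence an alternating word moves the trivial normal
    form, which starts on neither side. *)
Lemma alternating_neq1 s t x :
  alternating (letters amalgamated factor) s t x -> x <> 1.
Proof.
case: amalgG => inj_iA inj_iB jAB univ.
have [kA [kAM iAK]] := equivariant_retraction inj_iA.
have [kB [kBM iBK]] := equivariant_retraction inj_iB.
have [u [uA uB _]] := univ _ _ _ (act_amalgam kAM iAK kBM iBK).
pose St := @starts H A B iA iB kA kB.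
have disj r v : St r v -> ~ St (~~ r) v.
  case: r; first exact: starts_disjoint.
  by move=> Fv Tv; apply: (starts_disjoint kAM iAK Tv Fv).
move=> altx; have {altx} moves: forall v, ~ St t v -> St s (u x v).
  elim: altx => {s t x} [s x|s t r x y _ IHx _ IHy].
    case: s => -[[a _ <-] nHa] v nSv; [rewrite uA | rewrite uB].
      apply: actA_starts nSv => -[h _ eq_a]; apply: nHa; exists h => //=.
      by rewrite eq_a.
    apply: actB_starts nSv => -[h _ eq_a]; apply: nHa; exists h => //=.
    by rewrite jAB eq_a.
  move=> v nSv; have := IHy v nSv; rewrite gmulfM => Sy; apply: IHx => St_t.
  exact: disj St_t Sy.
move=> x1; have [nbT nbF] := starts_base iB kB iAK.
have nb r : ~ St r (1, Empty) by case: r.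
by have := moves _ (nb t); rewrite x1 hom1; apply: nb.
Qed.

End NormalForm.

(** * Words that die when a letter enters the amalgamated subgroup *)

Section Amalgam.
Variables (G : groupType) (H0 : set G) (X : bool -> set G).
Hypotheses (subH : is_subgroup H0) (subX : forall s, is_subgroup (X s)).
Hypothesis subHX : forall s, H0 `<=` X s.

Local Notation L := (letters H0 X).

Lemma letterV s x : L s x -> L s x^-1.
Proof.
move=> [Xx nHx]; split; first exact: (subgroupV (subX s)).
by move=> /(subgroupV subH); rewrite invgK.
Qed.

Lemma letterMl s h x : H0 h -> L s x -> L s (h * x).
Proof.
move=> Hh [Xx nHx]; split.
  by apply: (subgroupM (subX s)) => //; apply: subHX.
move=> Hhx; apply: nHx; rewrite -(mulKg h x).
by apply: (subgroupM subH) => //; apply: (subgroupV subH).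
Qed.

(** The condition on [f] says that [f] fails to separate [x] from [H0]; asking
    for [f y = 1] for all such [f] makes the non-triviality of [y] an
    obstruction to residual properties when [x] cannot be separated. *)
Definition killed_with (x y : G) : Prop :=
  forall (K : groupType) (f : {multiplicative G -> K}),
    (f @` H0) (f x) -> f y = 1.

(** The word [u^-1 * r * v] is a commutator of weight [n + 1] in [u] and [v],
    the quotient [u^-1 * v] standing for weight 1. Since
    [[~ u^-1 * r * v, u] = v^-1 * (r^-1 * u^-1 * r * v) * u], the words keep the
    same shape, with [u] and [v] exchanged, and stay alternating. When [u] and
    [v] are sent into a group [range i], the [n]-th commutator goes to its
    [n]-th lower central term. *)
Lemma iterated_commutator n s u v :
    alternating L s s u -> alternating L (~~ s) (~~ s) v ->
  exists r, (r = 1 \/ alternating L (~~ s) s r) /\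
    forall (K : groupType) (f : {multiplicative G -> K})
        (H : groupType) (i : {multiplicative H -> K}),
      range i (f u) -> range i (f v) ->
      (i @` lower_central n) (f (u^-1 * r * v)).
Proof.
elim: n s u v => [|n IHn] s u v altu altv.
  exists 1; split=> [|K f H i iu iv]; first by left.
  rewrite mulg1 gmulfM; apply: (subgroupM (subgroup_range i)) => //.
  by rewrite homV; apply: (subgroupV (subgroup_range i)).
have [r [altr central_r]] := IHn (~~ s) v u altv ltac:(by rewrite negbK).
rewrite negbK in altr.
exists (r^-1 * v^-1 * r * u); split; last first.
  move=> K f H i iu iv.
  have -> : u^-1 * (r^-1 * v^-1 * r * u) * v = [~ v^-1 * r * u, v].
    by rewrite commgEl conjgE !invgM invgK !mulgA mulgK.
  rewrite homR; have [h Lh <-] := central_r K f H i iv iu.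
  case: iv => k _ <-; exists [~ h, k]; last by rewrite homR.
  by apply: sub_gen_smallest; exists h => //; exists k.
have altVv := alternatingV letterV altv; right.
case: altr => [->|altr].
  by rewrite invg1 mul1g mulg1; apply: alternating_mul altVv _; rewrite negbK.
apply: (alternating_mul (t := ~~ s)); last by rewrite negbK.
apply: (alternating_mul (t := ~~ s)); last by rewrite negbK.
apply: (alternating_mul (t := s)) altVv.
exact: (alternatingV letterV).
Qed.

(** If [f x] lies in [f H0] then so does [f (x ^ b)], because [b] normalizes
    [H0]; so both lie in a nilpotent group, where long commutators vanish,
    although in the amalgam they are alternating. *)
Lemma normalizing_letter_kills s x b (H : groupType)
    (i : {multiplicative H -> G}) :
    H0 = range i -> nilpotent_group H ->
    L s x -> L (~~ s) b -> (forall h, H0 h -> H0 (h ^ b)) ->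
  exists t u y, alternating L t u y /\ killed_with x y.
Proof.
move=> defH [n cH] Lx Lb nHb.
have altx := alternating_letter Lx; have altb := alternating_letter Lb.
have altVb := alternatingV letterV altb.
have altVx := alternatingV letterV altx.
have altc : alternating L (~~ s) (~~ s) (x ^ b).
  apply: alternating_mul altVb _; rewrite negbK.
  exact: alternating_mul altx altb.
have [r [altr central_r]] := iterated_commutator n altx altc.
exists s, (~~ s), (x^-1 * r * x ^ b); split.
  case: altr => [->|altr].
    by rewrite mulg1; apply: alternating_mul altVx _.
  by apply: alternating_mul altc; apply: alternating_mul altVx _.
move=> K f Hfx.
have defHf : f @` H0 = range (f \o i) by rewrite defH image_comp.
have [||h] := central_r K f H (f \o i).
- by rewrite -defHf.
- case: Hfx => h Hh fh; rewrite -defHf homJ -fh -homJ.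
  by exists (h ^ b) => //; apply: nHb.
- by rewrite cH => -> <-; rewrite hom1.
Qed.

(** The letters [b] and [b'] represent, with 1, three different cosets of [H0]
    on their side. The elements [p n] are chosen such that no quotient
    [(p m)^-1 * p n] loses its alternating shape, so that the [g k] generate
    freely: a reduced word in them is an alternating word. *)
Section Identity.
Variables (s : bool) (x b b' : G).
Hypotheses (Lx : L s x) (Lb : L (~~ s) b) (Lb' : L (~~ s) b').
Hypothesis Lbb' : L (~~ s) (b'^-1 * b).

Let p n := (b * x) ^+ n * b'.
Let g k := p k.*2 * x * (p k.*2.+1)^-1.

Lemma alternating_prefix n : alternating L (~~ s) (~~ s) (p n).
Proof.
rewrite /p; elim: n => [|n IHn].
  by rewrite expg0 mul1g; apply: alternating_letter.
rewrite expgS -2!mulgA; apply: alternating_mul (alternating_letter Lb) _.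
by rewrite negbK; apply: alternating_mul (alternating_letter Lx) _.
Qed.

Lemma alternating_prefix_quotient m n :
  m != n -> alternating L (~~ s) (~~ s) ((p m)^-1 * p n).
Proof.
wlog lt_mn : m n / (m < n)%N => [wlog_mn|_].
  rewrite neq_ltn => /orP[] lt_mn.
    by apply: wlog_mn => //; rewrite ltn_eqF.
  rewrite -[p n]invgK -invgM; apply: (alternatingV letterV).
  by apply: wlog_mn => //; rewrite ltn_eqF.
rewrite /p -(subnKC lt_mn) addSnnS expgnDr invgM -mulgA -mulgA mulKg.
rewrite expgS mulgA [b'^-1 * _]mulgA -!mulgA [_ * (_ * (_ * _))]mulgA.
apply: alternating_mul (alternating_letter Lbb') _; rewrite negbK.
exact: alternating_mul (alternating_letter Lx) (alternating_prefix _).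
Qed.

Lemma alternating_eval_word w : w <> [::] -> reduced w ->
  alternating L (~~ s) (~~ s) (eval_word g w).
Proof.
(* The letter [g k] reads [p (2 k) * x * (p (2 k + 1))^-1], and its inverse
   [p (2 k + 1) * x^-1 * (p (2 k))^-1]. *)
pose idx (a : nat * bool) := if a.2 then a.1.*2 else a.1.*2.+1.
pose z (a : nat * bool) := if a.2 then x else x^-1.
pose dual (a : nat * bool) := (a.1, ~~ a.2).
have evalE a : (if a.2 then g a.1 else (g a.1)^-1) =
    p (idx a) * (z a * (p (idx (dual a)))^-1).
  by case: a => k []; rewrite /g /idx /z /= ?invgM ?invgK -?mulgA.
have altz a : alternating L s s (z a).
  rewrite /z; case: a.2; first exact: alternating_letter.
  by apply: alternating_letter; apply: letterV.
have altp a := alternatingV letterV (alternating_prefix (idx a)).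
suff: w <> [::] -> reduced w -> exists2 y, alternating L s (~~ s) y &
    eval_word g w = p (idx (head (0, true)%N w)) * y.
  move=> /[apply] /[apply] -[y alty ->].
  by apply: (alternating_mul (alternating_prefix _)); rewrite negbK.
elim: w => // a w IHw _; rewrite /reduced /= => red_w.
rewrite /eval_word big_cons evalE -mulgA -/(eval_word g w).
case: w => [|a' w] in IHw red_w *.
  exists (z a * (p (idx (dual a)))^-1).
    exact: alternating_mul (altz a) (altp _).
  by rewrite /eval_word big_nil mulg1.
move: red_w => /= /andP[red_aa' red_w].
have [//||y alty ->] := IHw; first exact: red_w.
exists (z a * ((p (idx (dual a)))^-1 * p (idx a') * y)).
  apply: alternating_mul (altz a) _.
  apply: (alternating_mul (t := ~~ s)); last by rewrite negbK.
  apply: alternating_prefix_quotient; move: red_aa'; rewrite /idx /=.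
  case: a => k e; move: (a') => [k' e'] /=.
  case: e e' => [] [] /=; rewrite ?andbT ?andbF => red_aa'.
  - by apply/eqP => /(congr1 odd) /=; rewrite !odd_double.
  - by apply: contra red_aa' => /eqP[] /double_inj ->.
  - by apply: contra red_aa' => /eqP /double_inj ->.
  - by apply/eqP => /(congr1 odd) /=; rewrite !odd_double.
by rewrite !mulgA.
Qed.

End Identity.

(** If [f x] lies in [f H0], then the free generators [g k] go into [f M], so
    that the word [w], an identity of [M], vanishes on their images; it does
    not vanish on the [g k] themselves. The third coset comes from [b] not
    normalizing [H0]. *)
Lemma identity_kills s x b h (M : set G) :
    is_subgroup M -> M `<=` X (~~ s) -> H0 `<=` M ->
    satisfies_nontrivial_identity M ->
    L s x -> M b -> ~ H0 b -> H0 h -> ~ H0 (h ^ b) ->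
  exists t u y, alternating L t u y /\ killed_with x y.
Proof.
move=> subM MX HM [w [w_neq0 red_w idM]] Lx Mb nHb Hh nHhb.
have Lb : L (~~ s) b by split=> //; apply: MX.
have Lhb : L (~~ s) (h * b) by apply: letterMl.
have Lq : L (~~ s) ((h * b)^-1 * b).
  have -> : (h * b)^-1 * b = (h ^ b)^-1 by rewrite conjgE !invgM invgK.
  apply: letterV; split=> //; apply: MX.
  by rewrite conjgE; do ?apply: (subgroupM subM) => //;
    [apply: (subgroupV subM) | apply: HM].
pose p n := (b * x) ^+ n * (h * b).
pose g k := p k.*2 * x * (p k.*2.+1)^-1.
exists (~~ s), (~~ s), (eval_word g w); split.
  exact: (alternating_eval_word Lx Lb Lhb Lq w_neq0 red_w).
move=> K f [h' Hh' fh'].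
have subfM := subgroup_image subM f.
have fM y : M y -> (f @` M) (f y) by move=> My; exists y.
have fMp n : (f @` M) (f (p n)).
  rewrite gmulfM homX gmulfM -fh'; apply: (subgroupM subfM).
    apply: (subgroupX subfM).
    by apply: (subgroupM subfM); apply: fM => //; apply: HM.
  by apply: fM; apply: (subgroupM subM) => //; apply: HM.
have fMg k : exists v, M v /\ f v = f (g k).
  suff [v Mv fv] : (f @` M) (f (g k)) by exists v.
  rewrite (gmulfM (p k.*2 * x)) (gmulfM (p k.*2)) homV -fh'.
  apply: (subgroupM subfM); last exact: (subgroupV subfM).
  by apply: (subgroupM subfM) => //; apply: fM; apply: HM.
have [v fv] := choice fMg.
rewrite hom_eval_word -[RHS](hom1 f) -(idM v) => [|k]; last by case: (fv k).
rewrite hom_eval_word; congr eval_word.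
by apply: funext => k /=; case: (fv k).
Qed.

(** The hypothesis made on each factor, transported into the amalgam. *)
Definition normalizer_or_identity (Y : set G) : Prop :=
  (exists b, [/\ Y b, ~ H0 b & forall h, H0 h -> H0 (h ^ b)]) \/
  (exists M, [/\ is_subgroup M, M `<=` Y, H0 `<` M &
                 satisfies_nontrivial_identity M]).

(** Either some element of [M] outside [H0] normalizes [H0], and iterated
    commutators serve, or any such element provides a third coset of [H0]. *)
Lemma exists_killed_word s x (H : groupType) (i : {multiplicative H -> G}) :
    H0 = range i -> nilpotent_group H ->
    normalizer_or_identity (X (~~ s)) -> L s x ->
  exists t u y, alternating L t u y /\ killed_with x y.
Proof.
move=> defH nilH [[b [Xb nHb normb]]|[M [subM MX [HM nMH] idM]]] Lx.
  exact: (normalizing_letter_kills defH nilH Lx _ normb).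
have [b Mb nHb] : exists2 b, M b & ~ H0 b.
  by move: nMH => /existsNP[b /not_implyP[Mb nHb]]; exists b.
have [normb|/existsNP[h /not_implyP[Hh nHhb]]] :=
  pselect (forall h, H0 h -> H0 (h ^ b)).
  apply: (normalizing_letter_kills defH nilH Lx _ normb).
  by split=> //; apply: MX.
exact: (identity_kills subM MX HM idM Lx Mb nHb Hh nHhb).
Qed.

(** * Conjugating alternating words *)

(** Conjugating by a letter of side [s] gives both ends of a word to that side,
    unless the new letter is absorbed by the first one. As [c * c] lies outside
    [H0], the letter [l] cannot be absorbed by [c] and by [c^-1] at once. *)
Lemma conjugate_alternating s c t u y :
    L s c -> L s (c * c) -> alternating L t u y ->
  exists g, alternating L s s (y ^ g).
Proof.
move=> Lc Lcc.
have exit l : L s l -> exists2 d, L s d & L s (d^-1 * l).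
  move=> Ll; have [Hcl|nHcl] := pselect (H0 (c^-1 * l)); last first.
    exists c => //; split=> //.
    apply: (subgroupM (subX s)); last by case: Ll.
    by apply: (subgroupV (subX s)); case: Lc.
  exists c^-1; first exact: letterV.
  rewrite invgK -[c]invgK; split; rewrite invgK.
    by apply: (subgroupM (subX s)); [case: Lc | case: Ll].
  move=> Hcl'; case: Lcc => _; apply.
  have -> : c * c = (c * l) * (c^-1 * l)^-1 by rewrite invgM invgK !mulgA mulgK.
  by apply: (subgroupM subH) => //; apply: (subgroupV subH).
have leading z : alternating L s (~~ s) z ->
    exists g, alternating L s s (z ^ g).
  move=> /alternating_first[[_ /eqP]|[l [z' [Ll altz' ->]]]].
    by case: (s).
  have [d Ld Ldl] := exit l Ll; exists d.
  rewrite conjgE -[_ * d]mulgA [d^-1 * _]mulgA.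
  apply: alternating_mul (alternating_letter Ldl) _.
  by apply: alternating_mul altz' _; rewrite negbK; apply: alternating_letter.
have dich (v : bool) : v = s \/ v = ~~ s by case: v (s) => [] []; auto.
case: (dich t) => ->; case: (dich u) => -> alty.
- by exists 1; rewrite conjg1.
- exact: leading.
- have [g altg] := leading _ (alternatingV letterV alty); exists g.
  by rewrite -[_ ^ g]invgK -conjVg; apply: (alternatingV letterV).
- have altc := alternating_letter Lc; exists c; rewrite conjgE.
  apply: alternating_mul (alternatingV letterV altc) _.
  by apply: alternating_mul alty _; rewrite negbK.
Qed.

(** In an infinite dihedral group all translations commute; this is the
    exception that the hypothesis on [c * c] excludes. With one conjugate
    beginning and ending on side [s] and the other one on the opposite side,
    nothing cancels in their commutator. *)
Lemma commutator_alternating s c b t1 u1 y1 t2 u2 y2 :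
    L s c -> L s (c * c) -> L (~~ s) b ->
    alternating L t1 u1 y1 -> alternating L t2 u2 y2 ->
  exists g1 g2 t u, alternating L t u [~ y1 ^ g1, y2 ^ g2].
Proof.
move=> Lc Lcc Lb /(conjugate_alternating Lc Lcc)[g1 alt1].
move=> /(conjugate_alternating Lc Lcc)[g2 alt2].
have altb := alternating_letter Lb.
have alt2b : alternating L (~~ s) (~~ s) (y2 ^ (g2 * b)).
  rewrite conjgM conjgE; apply: alternating_mul (alternatingV letterV altb) _.
  by rewrite negbK; apply: alternating_mul alt2 _.
exists g1, (g2 * b), s, (~~ s); rewrite commgEl conjgE.
apply: alternating_mul (alternatingV letterV alt1) _.
apply: alternating_mul (alternatingV letterV alt2b) _; rewrite negbK.
exact: alternating_mul alt1 alt2b.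
Qed.

End Amalgam.

(** * Images of homomorphisms *)

Section HomImage.
Variables (A K : groupType) (f : {multiplicative A -> K}).

Definition hom_image := {y : K | `[< range f y >]}.
HB.instance Definition _ := SubChoice.on hom_image.

Lemma hom_image_closed : group_closed (fun y : K => `[< range f y >]).
Proof.
have subf := subgroup_range f.
split=> [|x y]; first by apply/asboolP; apply: (proj1 subf).
by move=> /asboolP fx /asboolP fy; apply/asboolP; apply: (proj2 subf).
Qed.

HB.instance Definition _ :=
  SubChoice_isSubGroup.Build K (fun y => `[< range f y >]) hom_image
    hom_image_closed.

Definition to_image a : hom_image := exist _ (f a) (asboolT (imageT f a)).

Lemma to_imageM : {morph to_image : a b / a * b}.
Proof. by move=> a b; apply: val_inj; rewrite /= gmulfM. Qed.

HB.instance Definition _ :=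
  isMultiplicative.Build A hom_image to_image to_imageM.

Lemma to_image_surj : range to_image = [set: hom_image].
Proof.
apply/seteqP; split=> // -[y fy] _; have /asboolP[a _ fa] := fy.
by exists a => //; apply: val_inj.
Qed.

End HomImage.

Lemma P_group_root (P : set nat) (K : groupType) (x : K) (r : nat) :
  P_group P K -> prime r -> ~ P r -> exists m, (x ^+ r) ^+ m = x.
Proof.
move=> PK pr_r nPr; have [n [n_gt0 xn1 _] Pn] := PK x.
apply: coprime_root (prime_gt0 pr_r) _ xn1.
by rewrite prime_coprime //; apply/negP => /(Pn r pr_r).
Qed.

(** * Finite nilpotent groups *)

(** The equality of group structures lets the theory of finite groups apply to
    [K] by substitution, without transport along an isomorphism. *)
Lemma finite_groupE (K : groupType) : finite_set [set: K] ->
  exists gT : finGroupType, K = gT :> groupType.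
Proof.
move=> /finite_seqP[e eE].
have: Finite.axiom (undup e).
  apply: Finite.uniq_enumP (undup_uniq _) _ => x; rewrite mem_undup.
  by have : [set: K] x by []; rewrite eE /= => ->.
move: (undup e) => {eE} {}e enumP.
pose gT : finGroupType := HB.pack (Group.sort K)
  (Choice_isCountable.Build K (@fin_pickleK K _ enumP))
  (isFinite.Build K enumP).
by exists gT; subst gT; case: K e enumP => T [].
Qed.

Lemma nilpotent_group_finite (gT : finGroupType) :
  nilpotent_group gT -> nilpotent [set: gT]%G.
Proof.
move=> [n Ln]; apply/lcnP; exists n.
have subLn x m : x \in 'L_m.+1([set: gT]%G) -> @lower_central gT m x.
  elim: m x => [//|m IHm] x; rewrite lcnSn => Lx M [subM sM].
  have gM : group_set [set z : gT | `[< M z >]]%SET.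
    apply/group_setP; split=> [|y z]; rewrite !inE.
      exact: (proj1 subM).
    exact: (subgroupM subM).
  suff: x \in Group gM by rewrite !inE.
  apply: fintype.subsetP Lx; rewrite gen_subG.
  apply/fintype.subsetP => _ /imset2P[y z Ly _ ->].
  rewrite !inE; apply: sM; exists y; first exact: IHm.
  by exists z.
apply/trivgP/fintype.subsetP => x /subLn; rewrite Ln => ->; exact: finset.set11.
Qed.

Section QuotientHom.
Variables (G : groupType) (gT : finGroupType) (f : {multiplicative G -> gT}).
Variables (N : {group gT}) (nN : [set: gT]%G \subset 'N(N)).

Lemma coset_homM : {morph (fun x => coset N (f x)) : x y / x * y}.
Proof.
move=> x y.
by rewrite gmulfM coset_morphM ?(fintype.subsetP nN) ?finset.in_setT.
Qed.

Definition quotient_hom : {multiplicative G -> coset_of N} :=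
  HB.pack (fun x => coset N (f x))
    (isMultiplicative.Build G (coset_of N) _ coset_homM).

End QuotientHom.

(** Modulo the Sylow [r]-subgroup all orders are prime to [r], so [x] enters the
    image of [H0] together with [x ^+ r], and [y] dies there. *)
Lemma killed_pcore (G : groupType) (H0 : set G) (x y : G) (r : nat)
    (gT : finGroupType) (f : {multiplicative G -> gT}) :
    is_subgroup H0 -> nilpotent [set: gT]%G -> prime r -> H0 (x ^+ r) ->
  killed_with H0 x y -> f y \in 'O_r([set: gT]%G).
Proof.
move=> subH nilT pr_r Hxr kill.
have nO : [set: gT]%G \subset 'N('O_r([set: gT]%G)).
  exact: (normal_norm (pcore_normal _ _)).
have nOf z : f z \in 'N('O_r([set: gT]%G)).
  by rewrite (fintype.subsetP nO) ?finset.in_setT.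
pose phi : {multiplicative G -> coset_of 'O_r([set: gT]%G)} :=
  quotient_hom f nO.
suff Hphi : (phi @` H0) (phi x).
  by have := kill _ phi Hphi; apply: coset_idr.
have [m <-] : exists m, (phi x ^+ r) ^+ m = phi x.
  apply: (@coprime_root _ _ _ #[phi x]); rewrite ?prime_gt0 ?expg_order //.
  have hall := nilpotent_pcore_Hall r nilT.
  rewrite prime_coprime // -p'natE //.
  have : phi x \in ([set: gT]%G / 'O_r([set: gT]%G)).
    by apply: mem_quotient; rewrite finset.in_setT.
  move=> /order_dvdG /pnat_dvd; apply; rewrite card_quotient //.
  by case/and3P: hall.
rewrite -homX; apply: (subgroupX (subgroup_image subH phi)).
by exists (x ^+ r).
Qed.

Lemma pcores_commute (gT : finGroupType) (r q : nat) (y z a b : gT) :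
    nilpotent [set: gT]%G -> r != q ->
    y \in 'O_r([set: gT]%G) -> z \in 'O_q([set: gT]%G) ->
  [~ y ^ a, z ^ b] = 1.
Proof.
move=> nilT neq_rq Oy Oz.
have nO p : [set: gT]%G \subset 'N('O_p([set: gT]%G)).
  exact: (normal_norm (pcore_normal _ _)).
apply/eqP/commgP.
have /dprodP[_ _ cOO _] := nilpotent_pcoreC r nilT.
apply: commute_sym; apply: (centsP cOO); last first.
  by rewrite memJ_norm // (fintype.subsetP (nO r)) ?finset.in_setT.
rewrite memJ_norm; last by rewrite (fintype.subsetP (nO _)) ?finset.in_setT.
apply: fintype.subsetP Oz; apply: sub_pcore => p; rewrite !inE => /eqP->.
by rewrite eq_sym.
Qed.

(** * Residual properties of amalgams *)

Lemma normalizer_or_identity_image (H A G : groupType)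
    (i : {multiplicative H -> A}) (j : {multiplicative A -> G}) :
    injective j ->
    ~ self_normalizing (range i) \/
      properly_in_subgroup_with_identity (range i) ->
  normalizer_or_identity (range (j \o i)) (range j).
Proof.
move=> inj_j; have subi := subgroup_range i.
have rangeji a : range (j \o i) (j a) -> range i a.
  by case=> h _ /inj_j <-; exists h.
case=> [nself|[M [subM [iM nMi] [w [w_neq0 red_w idM]]]]].
  left; have [b [Nb nib]] : exists b, normalizer (range i) b /\ ~ range i b.
    apply: contrapT => no_b; apply: nself; apply/seteqP; split=> b.
      by move=> Nb; apply: contrapT => nib; apply: no_b; exists b.
    move=> ib y; split=> [iyb|iy]; last first.
      rewrite conjgE; apply: (subgroupM subi); first exact: (subgroupV subi).
      exact: (subgroupM subi).
    rewrite -(conjgK b y) conjgE invgK.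
    apply: (subgroupM subi) => //; apply: (subgroupM subi) => //.
    exact: (subgroupV subi).
  exists (j b); split; first by exists b.
    by move=> /rangeji.
  move=> _ [h _ <-]; have /(_ (i h)) [_] := Nb.
  by case=> [|k _ eq_k]; [exists h | exists k => //=; rewrite eq_k homJ].
right; exists (j @` M); split.
- exact: subgroup_image.
- by move=> _ [a _ <-]; exists a.
- split=> [_ [h _ <-]|jMi]; first by exists (i h) => //; apply: iM; exists h.
  by apply: nMi => a Ma; apply: rangeji; apply: jMi; exists a.
exists w; split=> // v Mv.
have lift k : exists a, M a /\ j a = v k by have [a Ma ja] := Mv k; exists a.
have [v' v'P] := choice lift.
have -> : v = j \o v' by apply: funext => k /=; case: (v'P k).
by rewrite -hom_eval_word idM ?hom1 // => k; case: (v'P k).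
Qed.

Section Amalgams.
Variables (H A B G : groupType).
Variables (iA : {multiplicative H -> A}) (iB : {multiplicative H -> B}).
Variables (jA : {multiplicative A -> G}) (jB : {multiplicative B -> G}).
Hypothesis amalgG : is_amalgamated_product iA iB jA jB.
Hypothesis nilH : nilpotent_group H.
Hypotheses
  (condA : ~ self_normalizing (range iA) \/
           properly_in_subgroup_with_identity (range iA))
  (condB : ~ self_normalizing (range iB) \/
           properly_in_subgroup_with_identity (range iB)).

Let H0 := amalgamated iA jA.
Let X := factor jA jB.
Local Notation L := (letters H0 X).

Lemma subgroup_amalgamated : is_subgroup H0.
Proof. exact: (subgroup_range (jA \o iA)). Qed.

Lemma subgroup_factor s : is_subgroup (X s).
Proof. by case: s; apply: subgroup_range. Qed.

Lemma sub_amalgamated_factor s : H0 `<=` X s.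
Proof.
move=> _ [h _ <-]; case: s => /=; first by exists (iA h).
by exists (iB h) => //; case: amalgG => _ _ ->.
Qed.

Lemma amalgamated_range : H0 = range (jB \o iB).
Proof.
by case: amalgG => _ _ jAB _; congr image; apply: funext => h; apply: jAB.
Qed.

Lemma left_factor_injective : injective jA.
Proof. exact: factor_injective amalgG. Qed.

Lemma right_factor_injective : injective jB.
Proof. exact: factor_injective (amalgam_swap amalgG). Qed.

Lemma letter_of_A a : ~ range iA a -> L true (jA a).
Proof.
move=> nHa; split; first by exists a.
by case=> h _ /left_factor_injective eq_a; apply: nHa; exists h.
Qed.

Lemma letter_of_B b : ~ range iB b -> L false (jB b).
Proof.
move=> nHb; split; first by exists b.
rewrite amalgamated_range; case=> h _ /right_factor_injective eq_b.
by apply: nHb; exists h.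
Qed.

Lemma factor_condition s : normalizer_or_identity H0 (X s).
Proof.
case: s; first exact: normalizer_or_identity_image left_factor_injective condA.
rewrite amalgamated_range.
exact: normalizer_or_identity_image right_factor_injective condB.
Qed.

Lemma letter_kills_word s x : L s x ->
  exists t u y, alternating L t u y /\ killed_with H0 x y.
Proof.
exact: (exists_killed_word subgroup_amalgamated subgroup_factor
          sub_amalgamated_factor erefl nilH (factor_condition (~~ s))).
Qed.

Lemma exists_letter s : exists x, L s x.
Proof.
have [[b [Xb nHb _]]|[M [_ MX [_ nMH] _]]] := factor_condition s.
  by exists b.
move: nMH => /existsNP[b /not_implyP[Mb nHb]]; exists b.
by split=> //; apply: MX.
Qed.

(** The word attached to [x] is not 1 and survives in some quotient; there [x]
    stays outside the image of [H0]. *)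
Lemma residually_separates_letter (C : groupType -> Prop) s x :
    residually C G -> L s x ->
  exists (K : groupType) (f : {multiplicative G -> K}),
    C K /\ ~ (f @` H0) (f x).
Proof.
move=> resG /letter_kills_word[t [u [y [alty kill]]]].
have [K [f [CK _ fy]]] := resG y (alternating_neq1 amalgG alty).
by exists K, f; split=> // /kill.
Qed.

(** In a [P]-group [f x] is a power of [f x ^+ r], so it cannot stay outside the
    subgroup [f @` H0] when [f (x ^+ r)] lies in it. *)
Lemma residually_isolated (C : groupType -> Prop) (P : set nat) s x r :
    (forall K, C K -> P_group P K) -> residually C G ->
    prime r -> ~ P r -> L s x -> ~ H0 (x ^+ r).
Proof.
move=> CP resG pr_r nPr Lx Hxr.
have [K [f [CK []]]] := residually_separates_letter resG Lx.
have [m <-] := P_group_root (f x) (CP K CK) pr_r nPr.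
rewrite -homX; apply: (subgroupX (subgroup_image subgroup_amalgamated f)).
by exists (x ^+ r).
Qed.

(** A quotient map of the amalgam restricts to a map from the factor onto a
    subgroup of the quotient, which is where closure under subgroups enters. *)
Lemma residually_separable (C : groupType -> Prop)
    (D : groupType) (Y : set D) (j : {multiplicative D -> G}) :
    closed_under_subgroups C -> residually C G -> j @` Y = H0 ->
    (forall a, ~ Y a -> exists s, L s (j a)) ->
  separable C Y.
Proof.
move=> closedC resG jY letterD a /letterD[s Lja].
have [K [f [CK nHf]]] := residually_separates_letter resG Lja.
exists (hom_image (f \o j)), (to_image (f \o j)); split.
- exact: closedC val_inj CK.
- exact: to_image_surj.
case=> y Yy /(congr1 val) /= fjy; apply: nHf; rewrite -fjy.
by exists (j y) => //; rewrite -jY; exists y.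
Qed.

(** At least one of the two primes is odd, which provides the letter whose
    square is a letter. In a finite nilpotent quotient the words attached to
    [x1] and [x2] lie in Sylow subgroups for different primes, so that all their
    conjugates commute; but some commutator of conjugates is alternating. *)
Lemma residually_nilpotent_root_unique s1 s2 x1 x2 r1 r2 :
    residually (fun K => finite_set [set: K] /\ nilpotent_group K) G ->
    prime r1 -> prime r2 -> r1 <> r2 -> L s1 x1 -> L s2 x2 ->
  H0 (x1 ^+ r1) -> H0 (x2 ^+ r2) -> False.
Proof.
move=> resG; wlog odd_r1 : s1 s2 x1 x2 r1 r2 / odd r1.
  move=> wlog_odd pr1 pr2 neq12 Lx1 Lx2 Hx1 Hx2.
  have [odd1|even1] := boolP (odd r1).
    exact: (wlog_odd s1 s2 x1 x2 r1 r2).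
  apply: (wlog_odd s2 s1 x2 x1 r2 r1) => //; last by move=> /esym.
  have [eq2|//] := even_prime pr2; case: neq12.
  by have [->|] := even_prime pr1; last by rewrite (negPf even1).
move=> pr1 pr2 neq12 Lx1 Lx2 Hx1 Hx2.
have subH := subgroup_amalgamated.
have Lx1x1 : L s1 (x1 * x1).
  have [Xx1 nHx1] := Lx1; split; first exact: (subgroupM (subgroup_factor s1)).
  move=> Hx1x1; apply: nHx1.
  have -> : x1 = x1 ^+ r1 * ((x1 * x1) ^+ r1./2)^-1.
    rewrite -expg2 -expgnA mul2n -{1}(odd_double_half r1) odd_r1.
    by rewrite expgnDr expg1 mulgK.
  by apply: (subgroupM subH) => //; apply: (subgroupV subH); apply: subgroupX.
have [b Lb] := exists_letter (~~ s1).
have [t1 [u1 [y1 [alt1 kill1]]]] := letter_kills_word Lx1.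
have [t2 [u2 [y2 [alt2 kill2]]]] := letter_kills_word Lx2.
have [g1 [g2 [t [u alty]]]] := commutator_alternating subH subgroup_factor
  Lx1 Lx1x1 Lb alt1 alt2.
have [K [f [[finK nilK] _]]] := resG _ (alternating_neq1 amalgG alty).
have [gT eqK] := finite_groupE finK; subst K; apply.
have nilT := nilpotent_group_finite nilK.
rewrite homR !homJ; apply: (pcores_commute _ _ nilT (introN eqP neq12)).
  exact: (killed_pcore f subH nilT pr1 Hx1 kill1).
exact: (killed_pcore f subH nilT pr2 Hx2 kill2).
Qed.

End Amalgams.

Theorem theorem5 (H A B G : groupType)
    (iA : {multiplicative H -> A}) (iB : {multiplicative H -> B})
    (jA : {multiplicative A -> G}) (jB : {multiplicative B -> G})
    (amalgG : is_amalgamated_product iA iB jA jB)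
    (P : set nat) (primeP : forall p, P p -> prime p) (P_neq0 : P !=set0)
    (nilH : nilpotent_group H)
    (alpha : ~ self_normalizing (range iA) \/
             properly_in_subgroup_with_identity (range iA))
    (beta : ~ self_normalizing (range iB) \/
            properly_in_subgroup_with_identity (range iB)) :
  (residually (finite_nilpotent_P_group P) G ->
   exists2 q, P q & isolated (compl_primes [set q]) (range iA) /\
                    isolated (compl_primes [set q]) (range iB)) /\
  (forall C : groupType -> Prop,
     (forall X, C X -> finite_P_group P X) ->
     closed_under_subgroups C ->
     residually C G ->
     [/\ separable C (range iA), separable C (range iB),
         isolated (compl_primes P) (range iA) &
         isolated (compl_primes P) (range iB)]).
Proof.
pose H0 := amalgamated iA jA; pose L := letters H0 (factor jA jB).
have LA a : ~ range iA a -> L true (jA a) by apply: letter_of_A amalgG a.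
have LB b : ~ range iB b -> L false (jB b) by apply: letter_of_B amalgG b.
have HA a : range iA a -> H0 (jA a) by case=> h _ <-; exists h.
have HB b : range iB b -> H0 (jB b).
  by rewrite /H0 (amalgamated_range amalgG) => -[h _ <-]; exists h.
pose root r := exists s x, L s x /\ H0 (x ^+ r).
have isolatedAB (S : set nat) : (forall r, S r -> ~ root r) ->
    isolated S (range iA) /\ isolated S (range iB).
  move=> noroot; split=> r x Sr Hxr; apply: contrapT => nHx.
    apply: (noroot r Sr); exists true, (jA x); split; first exact: LA.
    by rewrite -homX; apply: HA.
  apply: (noroot r Sr); exists false, (jB x); split; first exact: LB.
  by rewrite -homX; apply: HB.
have noroot_compl (C : groupType -> Prop) r :
    (forall K, C K -> P_group P K) -> residually C G -> compl_primes P r ->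
    ~ root r.
  move=> CP resG [pr_r nPr] [s [x [Lx]]].
  exact: (residually_isolated amalgG nilH alpha beta CP resG pr_r nPr Lx).
split=> [resG|C CP closedC resG].
  have CP K : finite_nilpotent_P_group P K -> P_group P K by case=> -[].
  have resG' : residually (fun K => finite_set [set: K] /\ nilpotent_group K) G.
    move=> x /resG[K [f [[[finK _] nilK] surjf fx]]].
    by exists K, f.
  (* If no prime of [P] occurs as the exponent of a missing root, any [q] will
     do; otherwise [q] has to be the only such prime. *)
  have [q Pq rootq] : exists2 q, P q &
      forall r, prime r -> P r -> root r -> root q.
    have [[q [Pq rq]]|no_root] := pselect (exists q, P q /\ root q).
      by exists q.
    have [q Pq] := P_neq0; exists q => // r _ Pr rr.
    by case: no_root; exists r.
  exists q => //; apply: isolatedAB => r [pr_r neq_rq] root_r.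
  have Pr : P r by apply: contrapT => nPr; apply: (noroot_compl _ r CP resG).
  have [s [x [Lx Hx]]] := root_r.
  have [s' [x' [Lx' Hx']]] := rootq r pr_r Pr root_r.
  exact: (residually_nilpotent_root_unique amalgG nilH alpha beta resG' pr_r
            (primeP q Pq) neq_rq Lx Lx' Hx Hx').
have [isoA isoB] : isolated (compl_primes P) (range iA) /\
    isolated (compl_primes P) (range iB).
  by apply: isolatedAB => r; apply: (noroot_compl C r) resG => K /CP[].
have sep := residually_separable amalgG nilH alpha beta closedC resG.
split=> //.
- apply: (sep A (range iA) jA) => [|a /LA La]; last by exists true.
  by rewrite image_comp.
- apply: (sep B (range iB) jB) => [|b /LB Lb]; last by exists false.
  by rewrite image_comp (amalgamated_range amalgG).
Qed.
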